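(* Let $\mathfrak t$ be a semibounded sesquilinear form in a complex Hilbert space $\mathfrak H$, let $c\le m(\mathfrak t)$, and assume that $\mathfrak t$ has the representation $$\mathfrak t[\varphi,\psi]=c(\varphi,\psi)+(Q\varphi,Q\psi),\qquad\varphi,\psi\in\operatorname{dom}\mathfrak t=\operatorname{dom}Q,$$ where $Q$ is a representing map for $\mathfrak t-c$, i.e. a linear operator from $\mathfrak H$ to a Hilbert space $\mathfrak K$ for which this representation holds. Let $K\in\mathbf B(\mathfrak K)$ be a nonnegative contraction which satisfies the conditions $$\operatorname{clos}\{k\in\overline{\operatorname{ran}}(I-K):\ (I-K)^{1/2}k\in\operatorname{dom}Q^*\}=\overline{\operatorname{ran}}(I-K),\qquad(1)$$ $$\operatorname{ran}K^{1/2}\cap\operatorname{dom}Q^*\subset\ker Q^*,\qquad(2)$$ and define the forms $\mathfrak t_1$ and $\mathfrak t_2$ on $\operatorname{dom}\mathfrak t$ by $$\mathfrak t_1[\varphi,\psi]=c(\varphi,\psi)+((I-K)^{1/2}Q\varphi,(I-K)^{1/2}Q\psi),\qquad\mathfrak t_2[\varphi,\psi]=(K^{1/2}Q\varphi,K^{1/2}Q\psi).\qquad(3)$$ Then the sum $\mathfrak t=\mathfrak t_1+\mathfrak t_2$ is a Lebesgue type decomposition of $\mathfrak t$. Conversely, let the sum $\mathfrak t=\mathfrak t_1+\mathfrak t_2$ be a Lebesgue type decomposition of $\mathfrak t$. Then there exists a nonnegative contraction $K\in\mathbf B(\mathfrak K)$ such that (1), (2), and (3) are satisfied.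
   Context: A (sesquilinear) form $\mathfrak t$ in $\mathfrak H$ is a map $\operatorname{dom}\mathfrak t\times\operatorname{dom}\mathfrak t\to\mathbb C$, linear in the first and antilinear in the second entry, where $\operatorname{dom}\mathfrak t$ is a (not necessarily dense) linear subspace of $\mathfrak H$; $\mathfrak t[\varphi]=\mathfrak t[\varphi,\varphi]$. It is semibounded if there is $c\in\mathbb R$ with $\mathfrak t[\varphi]\ge c\|\varphi\|^2$ on $\operatorname{dom}\mathfrak t$; the greatest such $c$ is the lower bound $m(\mathfrak t)\in\mathbb R$. The form $\mathfrak t-c$ is $\mathfrak t[\varphi,\psi]-c(\varphi,\psi)$ on $\operatorname{dom}\mathfrak t$. A form is nonnegative if $\mathfrak t[\varphi]\ge0$ on $\operatorname{dom}\mathfrak t$. A semibounded form $\mathfrak t$ is closable if for every sequence $\varphi_n\in\operatorname{dom}\mathfrak t$ with $\varphi_n\to0$ in $\mathfrak H$ and $\mathfrak t[\varphi_n-\varphi_m]\to0$ one has $\mathfrak t[\varphi_n]\to0$. A nonnegative form $\mathfrak t$ is singular if for every $\varphi\in\operatorname{dom}\mathfrak t$ there is a sequence $\varphi_n\in\operatorname{dom}\mathfrak t$ with $\varphi_n\to\varphi$ in $\mathfrak H$ and $\mathfrak t[\varphi_n]\to0$. A sum decomposition $\mathfrak t=\mathfrak t_1+\mathfrak t_2$ with $\operatorname{dom}\mathfrak t=\operatorname{dom}\mathfrak t_1=\operatorname{dom}\mathfrak t_2$ is called a Lebesgue type (sum) decomposition of $\mathfrak t$ if $\mathfrak t_1$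 is semibounded and closable, and $\mathfrak t_2$ is nonnegative and singular. A nonnegative contraction is a bounded everywhere defined selfadjoint operator $K$ on $\mathfrak K$ with $0\le K\le I$; $\overline{\operatorname{ran}}$ is the closure of the range, $\operatorname{clos}$ is closure in $\mathfrak K$. Since $Q$ need not be densely defined, $Q^*$ is in general a linear relation: $Q^*=\{\{k,h\}\in\mathfrak K\times\mathfrak H:\ (h,\varphi)_{\mathfrak H}=(k,Q\varphi)_{\mathfrak K}\text{ for all }\varphi\in\operatorname{dom}Q\}$, with $\operatorname{dom}Q^*=\{k:\{k,h\}\in Q^*\text{ for some }h\}$ and $\ker Q^*=\{k:\{k,0\}\in Q^*\}$.
   Formalization: In the converse, the additional hypothesis c ≤ m(t_1) is assumed; it is necessary, since (3) forces t_1[φ] ≥ c‖φ‖², and c ≤ m(t) does not imply it, so the converse fails without it. *)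

(* Defs.v *)
From HB Require Import structures.
From mathcomp Require Import all_boot all_order all_algebra.
From mathcomp Require Import complex.
From mathcomp Require Import all_classical all_reals all_analysis.

Set Implicit Arguments.
Unset Strict Implicit.
Unset Printing Implicit Defensive.

Import Order.TTheory GRing.Theory Num.Theory numFieldNormedType.Exports.

Local Open Scope classical_set_scope.
Local Open Scope ring_scope.
Local Open Scope complex_scope.

(* The order on R[i] is the partial one: x <= y means that y - x is a
   nonnegative real number.  R[i]^o is R[i] with its usual topology. *)

(* {dot H for Num.conj}: positive definite hermitian forms, linear in the
   first entry and antilinear in the second one. *)
HB.mixin Record NormedModule_isHilbert (R : realType) H
    of NormedModule R[i] H := {
  inner : {dot H for Num.conj} ;
  inner_norm : forall x : H, `|x| ^+ 2 = inner x x
}.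

#[short(type="hilbertType")]
HB.structure Definition Hilbert (R : realType) :=
  { H of CompleteNormedModule R[i] H & NormedModule_isHilbert R H }.

Notation "(| x , y |)" := (inner x y)
  (at level 0, x at level 99, y at level 99, format "(| x ,  y |)") : ring_scope.

Definition subspace_set (C : pzRingType) (V : lmodType C) (D : set V) : Prop :=
  D 0 /\ forall (a : C) (x y : V), D x -> D y -> D (a *: x + y).

Section forms.
Context {R : realType}.

(* Only the values of a form on its domain are relevant; see [eq_form]. *)
Record sesq_form (H : hilbertType R) := Form {
  dom : set H ;
  form_val :> H -> H -> R[i] ;
  dom_subspace : subspace_set dom ;
  form_linearl : forall (a : R[i]) (x y z : H), dom x -> dom y -> dom z ->
    form_val (a *: x + y) z = a * form_val x z + form_val y z ;
  form_antilinearr : forall (a : R[i]) (x y z : H), dom x -> dom y -> dom z ->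
    form_val z (a *: x + y) = a^* * form_val z x + form_val z y
}.

(* Only the values of an operator on its domain are relevant. *)
Record operator (H K : hilbertType R) := Operator {
  op_dom : set H ;
  op_val :> H -> K ;
  op_dom_subspace : subspace_set op_dom ;
  op_linear : forall (a : R[i]) (x y : H), op_dom x -> op_dom y ->
    op_val (a *: x + y) = a *: op_val x + op_val y
}.

Section form_properties.
Context {H : hilbertType R}.
Implicit Types t s : sesq_form H.

Definition eq_form t s : Prop :=
  dom t = dom s /\ forall x y, dom t x -> dom t y -> t x y = s x y.

Definition is_lower_bound t (c : R) : Prop :=
  forall x, dom t x -> c%:C * `|x| ^+ 2 <= t x x.

Definition semibounded t : Prop := exists c, is_lower_bound t c.

(* Extended real valued: it is -oo if t is not semibounded, and +oo if t is
   defined on the zero subspace only. *)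
Definition lower_bound t : \bar R := ereal_sup (EFin @` is_lower_bound t).

Definition nonnegative_form t : Prop := forall x, dom t x -> 0 <= t x x.

Definition closable t : Prop :=
  forall u : nat -> H, (forall n, dom t (u n)) ->
    u @ \oo --> (0 : H) ->
    (fun p : nat * nat =>
       (t (u p.1 - u p.2) (u p.1 - u p.2) : R[i]^o)) @ (\oo, \oo)
      --> (0 : R[i]^o) ->
    (fun n => (t (u n) (u n) : R[i]^o)) @ \oo --> (0 : R[i]^o).

Definition singular t : Prop :=
  forall x, dom t x -> exists u : nat -> H,
    [/\ forall n, dom t (u n),
        u @ \oo --> x
      & (fun n => (t (u n) (u n) : R[i]^o)) @ \oo --> (0 : R[i]^o)].

Definition sum_decomposition t t1 t2 : Prop :=
  [/\ dom t1 = dom t, dom t2 = dom t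
    & forall x y, dom t x -> dom t y -> t x y = t1 x y + t2 x y].

Definition lebesgue_type_decomposition t t1 t2 : Prop :=
  [/\ sum_decomposition t t1 t2,
      semibounded t1 /\ closable t1
    & nonnegative_form t2 /\ singular t2].

Lemma add_scalar_linearl (c : R) t (a : R[i]) (x y z : H) :
  dom t x -> dom t y -> dom t z ->
  c%:C * (| a *: x + y, z |) + t (a *: x + y) z =
  a * (c%:C * (| x, z |) + t x z) + (c%:C * (| y, z |) + t y z).
Proof.
by move=> tx ty tz; rewrite form_linearl// linearPl/= !mulrDr addrACA mulrCA.
Qed.

Lemma add_scalar_antilinearr (c : R) t (a : R[i]) (x y z : H) :
  dom t x -> dom t y -> dom t z ->
  c%:C * (| z, a *: x + y |) + t z (a *: x + y) =
  a^* * (c%:C * (| z, x |) + t z x) + (c%:C * (| z, y |) + t z y).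
Proof.
by move=> tx ty tz; rewrite form_antilinearr// linearPr/= !mulrDr addrACA mulrCA.
Qed.

(* c (x, y) + t[x, y] *)
Definition add_scalar (c : R) t : sesq_form H :=
  Form (dom_subspace t) (@add_scalar_linearl c t) (@add_scalar_antilinearr c t).

End form_properties.

Section operator_properties.
Context {H K : hilbertType R}.
Implicit Type Q : operator H K.

Lemma gram_linearl Q (a : R[i]) (x y z : H) :
  op_dom Q x -> op_dom Q y -> op_dom Q z ->
  (| Q (a *: x + y), Q z |) = a * (| Q x, Q z |) + (| Q y, Q z |).
Proof. by move=> Qx Qy Qz; rewrite op_linear// linearPl. Qed.

Lemma gram_antilinearr Q (a : R[i]) (x y z : H) :
  op_dom Q x -> op_dom Q y -> op_dom Q z ->
  (| Q z, Q (a *: x + y) |) = a^* * (| Q z, Q x |) + (| Q z, Q y |).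
Proof. by move=> Qx Qy Qz; rewrite op_linear// linearPr. Qed.

(* (Q x, Q y) *)
Definition gram_form Q : sesq_form H :=
  Form (op_dom_subspace Q) (@gram_linearl Q) (@gram_antilinearr Q).

Lemma op_comp_linear (T : {linear K -> K}) Q (a : R[i]) (x y : H) :
  op_dom Q x -> op_dom Q y ->
  T (Q (a *: x + y)) = a *: T (Q x) + T (Q y).
Proof. by move=> Qx Qy; rewrite op_linear// linearP. Qed.

Definition op_comp (T : {linear K -> K}) Q : operator H K :=
  @Operator H K (op_dom Q) (T \o Q) (op_dom_subspace Q) (@op_comp_linear T Q).

(* Q need not be densely defined: the adjoint is a linear relation. *)
Definition adjoint Q : set (K * H) :=
  [set kh | forall x, op_dom Q x -> (| kh.2, x |) = (| kh.1, Q x |)].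

Definition dom_adjoint Q : set K := [set k | exists h, adjoint Q (k, h)].

Definition ker_adjoint Q : set K := [set k | adjoint Q (k, 0)].

End operator_properties.

Section bounded_operators.
Context {K : hilbertType R}.
Implicit Types T S : {linear K -> K}.

Definition bounded_operator T : Prop :=
  exists M : R, forall k, `|T k| <= M%:C * `|k|.

Definition selfadjoint T : Prop := forall k l, (| T k, l |) = (| k, T l |).

Definition nonnegative_operator T : Prop :=
  [/\ bounded_operator T, selfadjoint T & forall k, 0 <= (| T k, k |)].

Definition complement T : {linear K -> K} := idfun \- T.

Definition nonnegative_contraction T : Prop :=
  nonnegative_operator T /\ forall k, (| T k, k |) <= (| k, k |).

(* The nonnegative square root; it exists and is unique if T is a nonnegative
   bounded operator, and the value is a default one otherwise. *)
Definition sqrt_operator T : {linear K -> K} :=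
  get [set S : {linear K -> K} |
    nonnegative_operator S /\ forall k, S (S k) = T k].

End bounded_operators.

Section contraction_conditions.
Context {H K : hilbertType R}.
Implicit Types (Q : operator H K) (T : {linear K -> K}).

Definition closability_condition Q T : Prop :=
  closure [set k | closure (range (complement T)) k /\
                   dom_adjoint Q (sqrt_operator (complement T) k)] =
  closure (range (complement T)).

Definition singularity_condition Q T : Prop :=
  range (sqrt_operator T) `&` dom_adjoint Q `<=` ker_adjoint Q.

Definition contraction_form1 (c : R) Q T : sesq_form H :=
  add_scalar c (gram_form (op_comp (sqrt_operator (complement T)) Q)).

Definition contraction_form2 Q T : sesq_form H :=
  gram_form (op_comp (sqrt_operator T) Q).

End contraction_conditions.

End forms.

(* Main.v *)
Require Import Defs.
From HB Require Import structures.
From mathcomp Require Import all_boot all_order all_algebra.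
From mathcomp Require Import complex.
From mathcomp Require Import all_classical all_reals all_analysis.
From mathcomp Require Import ring.

(* Closed graphs and closed subspaces are described by double orthogonal
   complements, which come from one Riesz lemma for nonnegative forms on
   possibly incomplete domains.

   Direct part: if u_n -> 0 and (I - K)^(1/2) Q u_n -> l, then l is orthogonal
   to the set in (1), hence to ran (I - K); so (I - K)^(1/2) l = 0, and then l
   is orthogonal to itself. If (h, k) is orthogonal to the graph of K^(1/2) Q,
   then K^(1/2) k is in dom Q^*, hence in ker Q^* by (2), so that h is
   orthogonal to dom Q; therefore {phi, 0} is in the closure of this graph for
   all phi in dom Q.

   Converse part: t_2 is dominated by (Q., Q.), so t_2 = (K Q., Q.) for a
   contraction K that vanishes on the orthogonal complement of ran Q. If r in
   clos ran (I - K) is orthogonal to the set in (1), then {0, r} is orthogonal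
   to the orthogonal complement of the graph of (I - K)^(1/2) Q, and r = 0
   because t_1 is closable. Condition (2) is read off along the sequences
   provided by the singularity of t_2. *)

Set Implicit Arguments.
Unset Strict Implicit.
Unset Printing Implicit Defensive.

Import Order.TTheory GRing.Theory Num.Theory numFieldNormedType.Exports.

Local Open Scope classical_set_scope.
Local Open Scope ring_scope.

(** * Convergence in complex normed spaces *)

(** The discriminant argument behind Cauchy-Schwarz. The constant [e] is kept independent of any
    form, so that the bound also serves the first variation in [riesz_form], where [e] is a
    minimization gap. *)
Lemma quadratic_bound (C : numClosedFieldType) (e s g : C) :
  0 <= e -> 0 <= s ->
  (forall a : C, 0 <= e + (a^* * g + a * g^*) + a * a^* * s) ->
  `|g| ^+ 2 <= e * s.
Proof.
move=> e0 s0 h; rewrite normCK; set G := g * g^*.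
have G0 : 0 <= G := mul_conjC_ge0 g.
(* Restricting to [a = - l * g] with [l] real leaves a real quadratic in [l]. *)
have {}h l : l \is Num.real -> 0 <= e - 2 * l * G + l ^+ 2 * G * s.
  move=> /conj_Creal lR; have := h (- l * g).
  rewrite rmorphM/= rmorphN/= lR -/G.
  by congr (0 <= _); rewrite /G; ring.
have [sE|sn0] := eqVneq s 0.
  have [->|Gn0] := eqVneq G 0; first by rewrite sE mulr0.
  (* For [s = 0] the expression is affine in [l], and this [l] would give it the negative value
     [- (e + 2)]. *)
  have lR : (e + 1) / G \is Num.real.
    by rewrite rpredM// ?rpredV ?rpredD// ger0_real.
  have := h _ lR; rewrite sE mulr0 addr0.
  have -> : e - 2 * ((e + 1) / G) * G = - (e + 2) by field.
  by rewrite oppr_ge0 => /le_lt_trans/(_ (ltr_wpDl e0 (ltr0n _ 2)));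
    rewrite ltxx.
have := h s^-1; rewrite rpredV ger0_real// => /(_ isT).
have -> : e - 2 * s^-1 * G + s^-1 ^+ 2 * G * s = e - G / s by field.
by rewrite subr_ge0 ler_pdivrMr// lt_neqAle eq_sym sn0.
Qed.

Section convergence.
Context {R : realType} {T : Type} {F : set_system T} {FF : Filter F}.
Implicit Types V W : normedModType R[i].

Lemma cvg0_sqr_le V W (f : T -> V) (g : T -> W) (M : R[i]) : 0 <= M ->
  (forall n, `|f n| ^+ 2 <= M * `|g n| ) -> g @ F --> 0 -> f @ F --> 0.
Proof.
move=> M0 fg /cvgr0Pnorm_lt g0; apply/cvgr0Pnorm_lt => e e0.
(* Dividing by [M + 1] covers the case [M = 0]. *)
have e'0 : 0 < e ^+ 2 / (M + 1) by rewrite divr_gt0 ?exprn_gt0 ?ltr_wpDl.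
near=> n.
have gn : `|g n| < e ^+ 2 / (M + 1) by near: n; exact: g0.
rewrite -(@ltr_pXn2r _ 2)// ?nnegrE ?(ltW e0)//.
apply: (le_lt_trans (fg n)).
rewrite (@le_lt_trans _ _ ((M + 1) * `|g n| ))//; last first.
  by rewrite mulrC -ltr_pdivlMr ?ltr_wpDl.
by rewrite ler_wpM2r// lerDl.
Unshelve. all: by end_near. Qed.

Lemma cvg0_le V W (f : T -> V) (g : T -> W) (M : R[i]) : 0 <= M ->
  (forall n, `|f n| <= M * `|g n| ) -> g @ F --> 0 -> f @ F --> 0.
Proof.
move=> M0 fg /cvgr0Pnorm_lt g0; apply/cvgr0Pnorm_lt => e e0.
have e'0 : 0 < e / (M + 1) by rewrite divr_gt0 ?ltr_wpDl.
near=> n.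
have gn : `|g n| < e / (M + 1) by near: n; exact: g0.
apply: (le_lt_trans (fg n)).
rewrite (@le_lt_trans _ _ ((M + 1) * `|g n| ))//; last first.
  by rewrite mulrC -ltr_pdivlMr ?ltr_wpDl.
by rewrite ler_wpM2r// lerDl.
Unshelve. all: by end_near. Qed.

Lemma cvg_le V W (f : T -> V) (g : T -> W) (a : V) (b : W) (M : R[i]) :
  0 <= M ->
  (forall n, `|f n - a| <= M * `|g n - b| ) -> g @ F --> b -> f @ F --> a.
Proof.
move=> M0 fg /subr_cvg0 gb; apply/subr_cvg0; exact: cvg0_le M0 fg gb.
Qed.

Lemma cvg_sqr_le V W (f : T -> V) (g : T -> W) (a : V) (M : R[i]) : 0 <= M ->
  (forall n, `|f n - a| ^+ 2 <= M * `|g n| ) -> g @ F --> 0 -> f @ F --> a.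
Proof. by move=> M0 fg g0; apply/subr_cvg0; exact: cvg0_sqr_le M0 fg g0. Qed.

Lemma cvg0_real (r : T -> R) :
  r @ F --> (0 : R) -> (fun n => (r n)%:C%C : R[i]^o) @ F --> (0 : R[i]^o).
Proof.
move=> /cvgr0Pnorm_lt r0; apply/cvgr0Pnorm_lt => e e0.
(* A positive element of [R[i]] is real, so the comparison can be made in [R]. *)
have eE : e = (complex.Re e)%:C%C by rewrite RRe_real// gtr0_real.
have e'0 : 0 < complex.Re e by rewrite -ltcR -eE.
near=> n.
have rn : `|r n| < complex.Re e by near: n; exact: r0.
by rewrite eE normc_def/= expr0n addr0 sqrtr_sqr ltcR.
Unshelve. all: by end_near. Qed.

End convergence.

Lemma cauchy_seq_cvg (R : realType) (V : completeNormedModType R[i])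
  (u : nat -> V) :
  (fun p : nat * nat => u p.1 - u p.2) @ (\oo, \oo) --> (0 : V) ->
  exists l : V, u @ \oo --> l.
Proof.
move=> /cvgr0Pnorm_lt u0; have : cvg (u @ \oo).
  apply: cauchy_cvg; apply/cauchy_ballP => e /u0.
  rewrite near_simpl => uN; rewrite near_map2.
  by apply: filterS uN => -[n m]/=; rewrite -ball_normE/=.
by move=> ul; exists (lim (u @ \oo)).
Qed.

(** * Nonnegative forms and inner products *)

Section subspaces.
Context {C : nzRingType} {V : lmodType C} {D : set V}.
Hypothesis DS : subspace_set D.

Lemma subspaceD x y : D x -> D y -> D (x + y).
Proof. by move=> Dx Dy; rewrite -[x]scale1r; exact: DS.2. Qed.

Lemma subspaceZ a x : D x -> D (a *: x).
Proof.
by move=> Dx; rewrite -[_ *: _]addr0; apply: DS.2 => //; exact: DS.1.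
Qed.

Lemma subspaceB x y : D x -> D y -> D (x - y).
Proof.
move=> Dx Dy; apply: subspaceD => //.
by rewrite -scaleN1r; exact: subspaceZ.
Qed.

End subspaces.

Section forms.
Context {R : realType} {H : hilbertType R} (q : sesq_form H).
Local Notation D := (dom q).
Let DS : subspace_set D := dom_subspace q.

Lemma formBl x y z : D x -> D y -> D z -> q (x - y) z = q x z - q y z.
Proof.
by move=> Dx Dy Dz; rewrite addrC -scaleN1r form_linearl// mulN1r addrC.
Qed.

Lemma form00 : q 0 0 = 0.
Proof.
by have := formBl DS.1 DS.1 DS.1; rewrite subr0 subrr.
Qed.

Lemma form_quadratic a x y : D x -> D y ->
  q (a *: y + x) (a *: y + x) =
  q x x + (a^* * q x y + a * q y x) + a * a^* * q y y.
Proof.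
move=> Dx Dy; have Day : D (a *: y + x) by exact: DS.2.
by rewrite form_linearl// !form_antilinearr//; ring.
Qed.

Hypothesis q0 : nonnegative_form q.

(** Symmetry is not built into [sesq_form]. Since [q] is real on the diagonal, the cross terms in
    [form_quadratic] are real for every [a]; the cases [a = 1] and [a = 'i] combine to the claim. *)
Lemma nonnegative_form_herm x y : D x -> D y -> q y x = (q x y)^*.
Proof.
move=> Dx Dy.
have h a : (a^* * q x y + a * q y x)^* = a^* * q x y + a * q y x.
  apply: conj_Creal; have /ger0_real := q0 (DS.2 a y x Dy Dx).
  rewrite form_quadratic// => h.
  have -> : a^* * q x y + a * q y x =
     q x x + (a^* * q x y + a * q y x) + a * a^* * q y y
     - q x x - a * a^* * q y y by ring.
  apply: rpredB; first by apply: rpredB => //; exact/ger0_real/q0.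
  by apply: rpredM; apply: ger0_real; [exact: mul_conjC_ge0|exact: q0].
have := h 1; have := h 'i.
rewrite !(rmorphD, rmorphM)/= !conjCK !rmorph1 !mul1r conjCi.
set S := q x y; set S' := q y x.
have i0 : ('i : R[i]) != 0 by exact: neq0Ci.
move=> h1 h2.
have {}h1 : S^* - S'^* = S' - S.
  apply: (mulfI i0); transitivity (- 'i * S + 'i * S'); last by ring.
  by rewrite -h1; ring.
apply: (@mulfI _ 2); first by rewrite pnatr_eq0.
transitivity (S + S' + (S' - S)); first by ring.
by rewrite -h1 -h2; ring.
Qed.

Lemma form_cauchy_schwarz x y : D x -> D y ->
  `|q x y| ^+ 2 <= q x x * q y y.
Proof.
move=> Dx Dy; apply: quadratic_bound; rewrite ?q0// => a.
by rewrite -nonnegative_form_herm// -form_quadratic// q0//; exact: DS.2.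
Qed.

End forms.

Section inner_product.
Context {R : realType} {H : hilbertType R}.
Implicit Types x y z : H.

Section inner_form.
Variables (D : set H) (DS : subspace_set D).

Let inner_form_linearl (a : R[i]) (x y z : H) : D x -> D y -> D z ->
  (| a *: x + y, z |) = a * (| x, z |) + (| y, z |).
Proof. by move=> _ _ _; rewrite linearPl. Qed.

Let inner_form_antilinearr (a : R[i]) (x y z : H) : D x -> D y -> D z ->
  (| z, a *: x + y |) = a^* * (| z, x |) + (| z, y |).
Proof. by move=> _ _ _; rewrite linearPr. Qed.

(** Makes Cauchy-Schwarz for the inner product a case of [form_cauchy_schwarz]. *)
Definition inner_form : sesq_form H :=
  Form DS inner_form_linearl inner_form_antilinearr.

End inner_form.

Lemma innerDl x y z : (| x + y, z |) = (| x, z |) + (| y, z |).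
Proof. exact: linearDl. Qed.

Lemma innerDr x y z : (| z, x + y |) = (| z, x |) + (| z, y |).
Proof. exact: linearDr. Qed.

Lemma innerBl x y z : (| x - y, z |) = (| x, z |) - (| y, z |).
Proof. exact: linearBl. Qed.

Lemma innerBr x y z : (| z, x - y |) = (| z, x |) - (| z, y |).
Proof. exact: linearBr. Qed.

Lemma innerNl x y : (| - x, y |) = - (| x, y |).
Proof. exact: linearNl. Qed.

Lemma innerZl a x y : (| a *: x, y |) = a * (| x, y |).
Proof. exact: linearZl_LR. Qed.

Lemma innerZr a x y : (| x, a *: y |) = a^* * (| x, y |).
Proof. exact: linearZr_LR. Qed.

Lemma inner0l x : (| 0, x |) = 0.
Proof. exact: linear0l. Qed.

Lemma inner0r x : (| x, 0 |) = 0.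
Proof. exact: linear0r. Qed.

Lemma innerC x y : (| x, y |) = (| y, x |)^*.
Proof. by rewrite hermC expr0 mul1r. Qed.

Lemma inner_ge0 x : 0 <= (| x, x |).
Proof. by rewrite -inner_norm exprn_ge0. Qed.

Lemma inner_eq0 x : (| x, x |) = 0 -> x = 0.
Proof.
by rewrite -inner_norm => /eqP; rewrite expf_eq0/= normr_eq0 => /eqP.
Qed.

Lemma subspace_setT : subspace_set [set: H].
Proof. by []. Qed.

Lemma cauchy_schwarz x y : `|(| x, y |)| <= `|x| * `|y|.
Proof.
rewrite -(@ler_pXn2r _ 2)// ?nnegrE ?mulr_ge0// exprMn !inner_norm.
apply: (@form_cauchy_schwarz _ _ (inner_form subspace_setT)) => // z _.
exact: inner_ge0.
Qed.

Section continuity.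
Context {T : Type} {F : set_system T} {FF : Filter F}.

Lemma cvg_inner_l (u : T -> H) (l y : H) : u @ F --> l ->
  (fun n => (| u n, y |) : R[i]^o) @ F --> ((| l, y |) : R[i]^o).
Proof.
apply: (@cvg_le _ _ _ _ R[i]^o H _ _ _ _ (`|y| )) => // n.
by have := cauchy_schwarz (u n - l) y; rewrite innerBl mulrC.
Qed.

Lemma cvg_inner_r (u : T -> H) (l y : H) : u @ F --> l ->
  (fun n => (| y, u n |) : R[i]^o) @ F --> ((| y, l |) : R[i]^o).
Proof.
apply: (@cvg_le _ _ _ _ R[i]^o H _ _ _ _ (`|y| )) => // n.
by have := cauchy_schwarz y (u n - l); rewrite innerBr.
Qed.

End continuity.

Lemma cvg_inner_unique (u : nat -> H) (l y : H) (a : R[i]) :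
  u @ \oo --> l -> (fun n => (| u n, y |) : R[i]^o) @ \oo --> (a : R[i]^o) ->
  (| l, y |) = a.
Proof.
move=> ul; apply: (@cvg_unique R[i]^o); first exact: norm_hausdorff.
exact: cvg_inner_l.
Qed.

(** Replacing [y] by a nearby [z] in [A] costs at most (N + |x|) |y - z|. The case [N = 0] is
    orthogonality to a closure; general [N] gives the norm bound in [riesz_operator]. *)
Lemma closure_inner_le (A : set H) x y (N : R[i]) : 0 <= N ->
  (forall z, A z -> `|(| x, z |)| <= N * `|z| ) -> closure A y ->
  `|(| x, y |)| <= N * `|y|.
Proof.
move=> N0 xA Ay; apply/ler_addgt0Pl => e e0.
pose b := N + `|x| + 1; have b0 : 0 < b by rewrite ltr_wpDl// addr_ge0.
have [z [Az]] := Ay _ (nbhsx_ballx y _ (divr_gt0 e0 b0)).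
rewrite -ball_normE/= => yz.
have -> : (| x, y |) = (| x, z |) + (| x, y - z |).
  by rewrite innerBr addrC subrK.
apply: (le_trans (ler_normD _ _)).
apply: (le_trans (lerD (xA _ Az) (cauchy_schwarz _ _))).
have zy : `|z| <= `|y| + `|y - z|.
  by rewrite -{1}[z](subrKC y) -[z - y]opprB (le_trans (ler_normB _ _)).
apply: (@le_trans _ _ (N * (`|y| + `|y - z| ) + `|x| * `|y - z| )).
  by rewrite lerD2r ler_wpM2l.
rewrite mulrDr -addrA addrC lerD2r -mulrDl.
apply: (@le_trans _ _ (b * `|y - z| )); first by rewrite ler_wpM2r// lerDl.
by rewrite mulrC -ler_pdivlMr// ltW.
Qed.

Lemma closure_orthogonal (A : set H) x y :
  (forall z, A z -> (| x, z |) = 0) -> closure A y -> (| x, y |) = 0.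
Proof.
move=> xA Ay; apply/eqP; rewrite -normr_le0 -(mul0r `|y| ).
by apply: closure_inner_le Ay => // z Az; rewrite xA// normr0 mul0r.
Qed.

Lemma cvg_closure (A : set H) (u : nat -> H) (l : H) :
  (forall n, A (u n)) -> u @ \oo --> l -> closure A l.
Proof.
move=> Au ul B /ul[n _ nB]; exists (u n); split; first exact: Au.
by apply: nB; exact: leqnn.
Qed.

Lemma cvg0_inner (T : Type) (F : set_system T) (FF : Filter F) (u : T -> H) :
  u @ F --> (0 : H) -> (fun n => (| u n, u n |) : R[i]^o) @ F --> (0 : R[i]^o).
Proof.
move=> /cvgr0Pnorm_lt u0; apply/cvgr0Pnorm_lt => e e0.
have se0 : 0 < sqrtC e by rewrite sqrtC_gt0.
near=> n.
have un : `|u n| < sqrtC e by near: n; exact: u0.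
have : `|(| u n, u n |) : R[i]| < e.
  rewrite -inner_norm ger0_norm ?exprn_ge0// -[e]sqrtCK.
  by rewrite ltr_pXn2r ?nnegrE// ltW.
exact.
Unshelve. all: by end_near. Qed.

Lemma cvg_inner (T : Type) (F : set_system T) (FF : Filter F) (u v : T -> H)
  (l m : H) : u @ F --> l -> v @ F --> m ->
  (fun n => (| u n, v n |) : R[i]^o) @ F --> ((| l, m |) : R[i]^o).
Proof.
move=> ul vm.
(* Only the first summand involves both sequences; the others converge by continuity in one
   entry. *)
have E : (fun n => (| u n, v n |) : R[i]) =
    (fun n => (| u n - l, v n - m |) + ((| u n, m |) + (| l, v n - m |))).
  by apply/funext => n; rewrite !innerBl !innerBr; ring.
have {1}-> : (| l, m |) = 0 + ((| l, m |) + (| l, m - m |)).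
  by rewrite subrr inner0r; ring.
rewrite E; have um : (fun n => v n - m) @ F --> m - m.
  by apply: cvgB => //; exact: cvg_cst.
apply: (@cvgD R[i] R[i]^o).
  (* By a b <= a^2 + b^2 the mixed term is dominated by [g], a sum of two squared norms tending to
     0. *)
  pose g n := (| u n - l, u n - l |) + (| v n - m, v n - m |).
  have g0 : (g : T -> R[i]^o) @ F --> (0 : R[i]^o).
    rewrite -[0 in X in _ --> X]addr0; apply: (@cvgD R[i] R[i]^o).
      by apply: cvg0_inner; apply/subr_cvg0.
    by apply: cvg0_inner; apply/subr_cvg0.
  apply: (@cvg0_le _ _ _ _ R[i]^o R[i]^o _ g 1 ler01 _ g0) => n.
  rewrite mul1r; have : `|(| u n - l, v n - m |)| <= `|g n|.
    apply: (le_trans (cauchy_schwarz _ _)).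
    rewrite /g -!inner_norm ger0_norm ?addr_ge0 ?exprn_ge0//.
    move: `|u n - l| `|v n - m| (normr_ge0 (u n - l)) (normr_ge0 (v n - m)).
    move=> a b a0 b0; apply: (@le_trans _ _ (2 * (a * b))).
      by rewrite ler_peMl ?mulr_ge0// ler1n.
    rewrite -subr_ge0.
    have -> : a ^+ 2 + b ^+ 2 - 2 * (a * b) = (a - b) ^+ 2 by ring.
    by rewrite -realEsqr rpredB ?ger0_real.
  exact.
by apply: (@cvgD R[i] R[i]^o); [exact: cvg_inner_l|exact: cvg_inner_r].
Qed.

End inner_product.

(** * Riesz representation and orthogonality *)

Lemma cvg_harmonicC (R : realType) :
  (fun n => n.+1%:R^-1 : R[i]^o) @ \oo --> (0 : R[i]^o).
Proof.
have E : (fun n => n.+1%:R^-1 : R[i]) = (fun n => (harmonic n : R)%:C%C).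
  by apply/funext => n; rewrite /harmonic fmorphV/= rmorph_nat.
by rewrite E; exact: cvg0_real (@cvg_harmonic R).
Qed.

Lemma cvg_harmonicD (R : realType) :
  (fun p => p.1.+1%:R^-1 + p.2.+1%:R^-1 : R[i]^o) @ (\oo, \oo) --> (0 : R[i]^o).
Proof.
have h := @cvg_harmonicC R.
rewrite -[0 in X in _ --> X]addr0.
apply: (@cvgD R[i] R[i]^o _ _ _ (fun p : nat * nat => p.1.+1%:R^-1)
  (fun p : nat * nat => p.2.+1%:R^-1)).
  by apply: cvg_comp h; exact: cvg_fst.
by apply: cvg_comp h; exact: cvg_snd.
Qed.

Section riesz.
Context {R : realType} {H : hilbertType R} (q : sesq_form H).
Hypothesis q0 : nonnegative_form q.
Variables (F : H -> R[i]) (M : R[i]).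
Local Notation D := (dom q).
Hypothesis F_antilinear : forall a x y, D x -> D y ->
  F (a *: x + y) = a^* * F x + F y.
Hypothesis F_bounded : forall y, D y -> `|F y| ^+ 2 <= M * q y y.
Hypothesis M0 : 0 <= M.

(* A minimizing sequence of the energy represents F: by the first variation,
   q (u n) y - F y is small relative to q y y. *)
Let energy y : R := complex.Re (q y y - (F y + (F y)^*)).

Let energyE y : D y -> (energy y)%:C%C = q y y - (F y + (F y)^*).
Proof.
move=> Dy; rewrite /energy RRe_real//.
apply: rpredB; first exact/ger0_real/q0.
by apply/CrealP; rewrite rmorphD/= conjCK addrC.
Qed.

(** This is 2 |F y| <= 2 sqrt (M q[y]) <= M + q[y], compared through squares. *)
Let energy_ge y : D y -> - M <= (energy y)%:C%C.
Proof.
move=> Dy; rewrite energyE// lerNl opprB lerBlDr.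
have qy := q0 Dy.
apply: (@le_trans _ _ (2 * `|F y| )).
  apply: (le_trans (real_ler_norm _)).
    by apply/CrealP; rewrite rmorphD/= conjCK addrC.
  by apply: (le_trans (ler_normD _ _)); rewrite norm_conjC mulr_natl mulr2n.
rewrite -(@ler_pXn2r _ 2)// ?nnegrE ?mulr_ge0 ?addr_ge0// exprMn.
apply: (@le_trans _ _ (2 ^+ 2 * (M * q y y))).
  by rewrite ler_wpM2l ?exprn_ge0// F_bounded.
rewrite -subr_ge0.
have -> : (M + q y y) ^+ 2 - 2 ^+ 2 * (M * q y y) = (M - q y y) ^+ 2 by ring.
by rewrite -realEsqr rpredB ?ger0_real.
Qed.

(** The domain need not be complete for [q], so [F] is represented only along a sequence, with
    explicit errors and an explicit Cauchy rate. Limits are taken afterwards in the ambient Hilbert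
    spaces. *)
Lemma riesz_form : exists u : nat -> H,
  [/\ forall n, D (u n),
      forall n y, D y -> `|q (u n) y - F y| ^+ 2 <= n.+1%:R^-1 * q y y
    & forall n m, q (u n - u m) (u n - u m) <=
                  2 * (n.+1%:R^-1 + m.+1%:R^-1)].
Proof.
have DS := dom_subspace q.
have infE : has_inf (energy @` D).
  split; first by exists (energy 0), 0 => //; exact: DS.1.
  exists (- complex.Re M) => _ [y Dy <-].
  by rewrite -lecR rmorphN/= RRe_real ?ger0_real// energy_ge.
have /choice[u uP] : forall n : nat, exists y, D y /\
    energy y < inf (energy @` D) + n.+1%:R^-1.
  move=> n.
  have [|_ [y Dy <-] yP] := @inf_adherent R (energy @` D) n.+1%:R^-1 _ infE.
    by rewrite invr_gt0.
  by exists y.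
have Du n : D (u n) by have [] := uP n.
have gap n y : D y -> `|q (u n) y - F y| ^+ 2 <= n.+1%:R^-1 * q y y.
  (* The energy of [u n] exceeds the infimum by less than [n.+1%:R^-1], so adding [a *: y] cannot
     lower it by more; this is a quadratic inequality in [a]. *)
  move=> Dy; apply: quadratic_bound => [||a]; rewrite ?q0// ?invr_ge0//.
  have Dz : D (a *: y + u n) by exact: DS.2.
  have : 0 <= n.+1%:R^-1 + (energy (a *: y + u n) - energy (u n)).
    have lez : inf (energy @` D) <= energy (a *: y + u n).
      by apply: ge_inf; [exact: infE.2|exists (a *: y + u n)].
    rewrite addrA subr_ge0; apply: (le_trans (ltW (uP n).2)).
    by rewrite [leRHS]addrC lerD2r.
  rewrite -ler0c rmorphD rmorphB/= !energyE// fmorphV/= rmorph_nat.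
  rewrite form_quadratic// F_antilinear// rmorphD rmorphM/= conjCK.
  rewrite [(q (u n) y - F y)^*]rmorphB/= -(nonnegative_form_herm q0 (Du n) Dy).
  by congr (0 <= _); ring.
exists u; split => // n m.
(* Both gap estimates are tested at [w] itself: [q w w] is the difference of the two errors, so its
   square is bounded by a multiple of [q w w], and one factor cancels. *)
set w := u n - u m; have Dw : D w by apply: subspaceB.
have qw := q0 Dw.
have [->|qw0] := eqVneq (q w w) 0.
  by rewrite mulr_ge0// addr_ge0// invr_ge0.
have {}qw : 0 < q w w by rewrite lt_def qw0.
rewrite -(@ler_pM2r _ (q w w))//.
have -> : q w w * q w w = `|q w w| ^+ 2 by rewrite gtr0_norm.
have {1}-> : q w w = (q (u n) w - F w) - (q (u m) w - F w).
  by rewrite {1}/w formBl//; ring.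
set a := q (u n) w - F w; set b := q (u m) w - F w.
apply: (@le_trans _ _ ((`|a| + `|b| ) ^+ 2)).
  by rewrite ler_pXn2r ?nnegrE ?addr_ge0// ler_normB.
apply: (@le_trans _ _ (2 * (`|a| ^+ 2 + `|b| ^+ 2))); last first.
  by rewrite -mulrA ler_wpM2l// mulrDl lerD// gap.
rewrite -subr_ge0.
have -> : 2 * (`|a| ^+ 2 + `|b| ^+ 2) - (`|a| + `|b| ) ^+ 2 =
  (`|a| - `|b| ) ^+ 2 by ring.
by rewrite -realEsqr rpredB ?normr_real.
Qed.

End riesz.

Lemma harmonic_cauchy_cvg (R : realType) (V : completeNormedModType R[i])
  (v : nat -> V) :
  (forall n m, `|v n - v m| ^+ 2 <= 2 * (n.+1%:R^-1 + m.+1%:R^-1)) ->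
  exists l : V, v @ \oo --> l.
Proof.
move=> vh; apply: cauchy_seq_cvg.
apply: (@cvg0_sqr_le _ _ _ _ V R[i]^o _ _ 2) (@cvg_harmonicD R) => // -[n m].
apply: (le_trans (vh n m)); rewrite ler_wpM2l//.
by rewrite ger0_norm// addr_ge0// invr_ge0.
Qed.

(** * Riesz vectors in the closure of a range, and closures of graphs *)

Section operators.
Context {R : realType} {H K : hilbertType R} (Q : operator H K).
Local Notation D := (op_dom Q).
Let DS : subspace_set D := op_dom_subspace Q.

Lemma op_subB x y : D x -> D y -> Q (x - y) = Q x - Q y.
Proof.
by move=> Dx Dy; rewrite addrC -scaleN1r op_linear// scaleN1r addrC.
Qed.

Lemma subspace_range : subspace_set (Q @` D).
Proof.
split.
  exists 0; first exact: DS.1.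
  by have := op_subB DS.1 DS.1; rewrite !subrr.
move=> a _ _ [x Dx <-] [y Dy <-].
by exists (a *: x + y); [exact: DS.2|rewrite op_linear].
Qed.

(** The vectors [u n] of [riesz_form] need not converge in [H], but [Q (u n)] is Cauchy in [K], and
    its limit represents [F]. *)
Lemma riesz_operator (F : H -> R[i]) (N : R[i]) : 0 <= N ->
  (forall a x y, D x -> D y -> F (a *: x + y) = a^* * F x + F y) ->
  (forall y, D y -> `|F y| <= N * `|Q y| ) ->
  exists e, [/\ closure (Q @` D) e, forall y, D y -> (| e, Q y |) = F y
               & `|e| <= N].
Proof.
move=> N0 FL FN.
have q0 : nonnegative_form (gram_form Q) by move=> y _; exact: inner_ge0.
have [||u [Du uF uC]] := @riesz_form _ _ (gram_form Q) q0 F (N ^+ 2) FL.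
- move=> y Dy; rewrite /= -inner_norm -exprMn.
  by rewrite ler_pXn2r ?nnegrE ?mulr_ge0// FN.
- by rewrite exprn_ge0.
have {}Du n : D (u n) := Du n.
have [|e ue] := @harmonic_cauchy_cvg _ K (Q \o u).
  by move=> n m; have := uC n m; rewrite /= -inner_norm op_subB//.
have De : closure (Q @` D) e by apply: cvg_closure ue => n; exists (u n).
have eF y : D y -> (| e, Q y |) = F y.
  move=> Dy; apply: cvg_inner_unique ue _.
  apply: (@cvg_sqr_le _ _ _ _ R[i]^o R[i]^o _ _ _ (`|Q y| ^+ 2) _ _
    (@cvg_harmonicC R)); first by rewrite exprn_ge0.
  move=> n; have E : `|n.+1%:R^-1 : R[i]| = n.+1%:R^-1.
    by rewrite ger0_norm// invr_ge0.
  by have := uF n y Dy; rewrite /= -inner_norm mulrC -{1}E.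
exists e; split => //.
(* Since [e] lies in the closure of the range, the bound on [F] extends to [e] itself. *)
have : `|(| e, e |)| <= N * `|e|.
  by apply: closure_inner_le De => // _ [y Dy <-]; rewrite eF// FN.
rewrite -inner_norm normrX normr_id expr2.
have [->|e0] := eqVneq e 0; first by rewrite normr0.
by rewrite ler_pM2r// normr_gt0.
Qed.

(* Double orthogonal complement of the graph, stated without the Hilbert
   space H x K. *)
Lemma graph_closure (phi : H) (psi : K) :
  (forall h k, (forall y, D y -> (| h, y |) + (| k, Q y |) = 0) ->
     (| h, phi |) + (| k, psi |) = 0) ->
  exists u : nat -> H,
    [/\ forall n, D (u n), u @ \oo --> phi & Q \o u @ \oo --> psi].
Proof.
move=> perp; pose q := add_scalar 1 (gram_form Q).
have qE y : q y y = `|y| ^+ 2 + `|Q y| ^+ 2 by rewrite /= !inner_norm mul1r.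
have q0 : nonnegative_form q.
  by move=> y _; rewrite qE addr_ge0 ?exprn_ge0.
(* [F] is the pairing of [(phi, psi)] with the graph, and [q] is the graph inner product; the limit
   [(h, k)] found below is the projection of [(phi, psi)] onto the closed graph. *)
pose F y := (| phi, y |) + (| psi, Q y |).
have FL a x y : D x -> D y -> F (a *: x + y) = a^* * F x + F y.
  move=> Dx Dy; rewrite /F op_linear// !innerDr !innerZr; ring.
pose M := `|phi| ^+ 2 + `|psi| ^+ 2.
have M0 : 0 <= M by rewrite addr_ge0 ?exprn_ge0.
have [|u [Du uF uC]] := @riesz_form _ _ q q0 F M FL _ M0.
  move=> y Dy; rewrite qE /F.
  apply: (@le_trans _ _ ((`|phi| * `|y| + `|psi| * `|Q y| ) ^+ 2)).
    rewrite ler_pXn2r ?nnegrE ?addr_ge0 ?mulr_ge0//.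
    by apply: (le_trans (ler_normD _ _)); rewrite lerD ?cauchy_schwarz.
  (* Cauchy-Schwarz in the plane, by Lagrange's identity. *)
  rewrite -subr_ge0 /M.
  have -> : (`|phi| ^+ 2 + `|psi| ^+ 2) * (`|y| ^+ 2 + `|Q y| ^+ 2) -
    (`|phi| * `|y| + `|psi| * `|Q y| ) ^+ 2 =
    (`|phi| * `|Q y| - `|psi| * `|y| ) ^+ 2 by ring.
  by rewrite -realEsqr rpredB ?rpredM ?normr_real.
have {}Du n : D (u n) := Du n.
have [|h uh] := @harmonic_cauchy_cvg _ H u.
  by move=> n m; apply: (le_trans _ (uC n m)); rewrite qE lerDl exprn_ge0.
have [|k uk] := @harmonic_cauchy_cvg _ K (Q \o u).
  move=> n m; apply: (le_trans _ (uC n m)).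
  by rewrite qE /= op_subB// lerDr exprn_ge0.
have perp_hk y : D y -> (| phi - h, y |) + (| psi - k, Q y |) = 0.
  move=> Dy; rewrite !innerBl.
  suff /(congr1 (fun z => F y - z)) : (| h, y |) + (| k, Q y |) = F y.
    by rewrite subrr => <-; rewrite /F; ring.
  apply: (@cvg_unique R[i]^o (@norm_hausdorff _ _)
    ((fun n => q (u n) y : R[i]^o) @ \oo)).
    apply: (@cvgD R[i] R[i]^o); last exact: cvg_inner_l.
    rewrite (_ : (fun n => _) = (fun n => (| u n, y |) : R[i]^o)).
      exact: cvg_inner_l.
    by apply/funext => n; rewrite mul1r.
  apply: (@cvg_sqr_le _ _ _ _ R[i]^o R[i]^o _ _ _ (q y y) (q0 _ Dy) _
    (@cvg_harmonicC R)).
  move=> n; have E : `|n.+1%:R^-1 : R[i]| = n.+1%:R^-1.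
    by rewrite ger0_norm// invr_ge0.
  by have := uF n y Dy; rewrite mulrC -{1}E.
(* The residual is orthogonal to [(h, k)], a limit of graph elements, and by [perp] to [(phi, psi)];
   hence it is orthogonal to itself. *)
have perp_lim : (| phi - h, h |) + (| psi - k, k |) = 0.
  apply: (@cvg_unique R[i]^o (@norm_hausdorff _ _)
    ((fun n => (| phi - h, u n |) + (| psi - k, Q (u n) |) : R[i]^o) @ \oo)).
    by apply: (@cvgD R[i] R[i]^o); exact: cvg_inner_r.
  rewrite (_ : (fun n => _) = (fun=> 0)); first exact: (@cvg_cst R[i]^o).
  by apply/funext => n; exact: perp_hk.
have : `|phi - h| ^+ 2 + `|psi - k| ^+ 2 = 0.
  rewrite !inner_norm (innerBr phi h (phi - h)) (innerBr psi k (psi - k)).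
  have := perp _ _ perp_hk.
  by rewrite addrACA -opprD perp_lim subr0.
move/eqP; rewrite paddr_eq0 ?exprn_ge0// !expf_eq0/= !normr_eq0 !subr_eq0.
by move=> /andP[/eqP -> /eqP ->]; exists u.
Qed.

End operators.

(** * Orthogonal projection onto the closure of a subspace *)

Section subspace_closure.
Context {R : realType} {H : hilbertType R} (D : set H).
Hypothesis DS : subspace_set D.

Let inclusion_linear (a : R[i]) (x y : H) : D x -> D y ->
  a *: x + y = a *: x + y.
Proof. by []. Qed.

Let inclusion : operator H H := @Operator R H H D id DS inclusion_linear.

(** The component [p1] is the Riesz vector of y |-> (p, y), obtained by viewing [D] as the range of
    its inclusion into [H]. *)
Lemma orthogonal_decomposition p : exists p1 p2,
  [/\ p = p1 + p2, closure D p1 & forall y, D y -> (| p2, y |) = 0].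
Proof.
have [||e [De eP _]] := @riesz_operator _ _ _ inclusion (fun y => (| p, y |))
  `|p| (normr_ge0 _).
- by move=> a x y _ _; rewrite innerDr innerZr.
- by move=> y _; exact: cauchy_schwarz.
exists e, (p - e); split.
- by rewrite addrC subrK.
- by move: De; rewrite image_id.
- by move=> y Dy; rewrite innerBl eP// subrr.
Qed.

(** For the converse, the component [p2] is orthogonal to [p] by assumption and to [p1] by closure,
    hence to itself. *)
Lemma closure_subspaceP p :
  closure D p <-> forall h, (forall y, D y -> (| h, y |) = 0) -> (| h, p |) = 0.
Proof.
split=> [Dp h hD|hp]; first exact: closure_orthogonal Dp.
have [p1 [p2 [pE Dp1 p2D]]] := orthogonal_decomposition p.
suff p20 : p2 = 0 by rewrite pE p20 addr0.
apply: inner_eq0; have := hp _ p2D.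
by rewrite pE innerDr (closure_orthogonal p2D Dp1) add0r.
Qed.

Lemma subspace_closure : subspace_set (closure D).
Proof.
split; first by apply: subset_closure; exact: DS.1.
move=> a x y /closure_subspaceP Dx /closure_subspaceP Dy.
by apply/closure_subspaceP => h hD;
  rewrite innerDr innerZr Dx// Dy// mulr0 addr0.
Qed.

(** The difference is orthogonal to [D], hence to [e] and [e']. This yields linearity of maps that
    are defined through their pairings with [D]. *)
Lemma closure_unique e e' : closure D e -> closure D e' ->
  (forall y, D y -> (| e, y |) = (| e', y |)) -> e = e'.
Proof.
move=> De De' ee'; apply/eqP; rewrite -subr_eq0; apply/eqP/inner_eq0.
have eD y : D y -> (| e - e', y |) = 0.
  by move=> Dy; rewrite innerBl ee'// subrr.
by rewrite innerBr !(closure_orthogonal eD)// subrr.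
Qed.

End subspace_closure.

Lemma closure_sequence (R : realType) (H : hilbertType R) (A : set H) (p : H) :
  closure A p -> exists2 u : nat -> H, forall n, A (u n) & u @ \oo --> p.
Proof.
move=> Ap; have /choice[u uP] : forall n : nat, exists x, A x /\
    `|x - p| <= n.+1%:R^-1.
  move=> n; have n0 : 0 < (n.+1%:R^-1 : R[i]) by rewrite invr_gt0.
  have [x [Ax]] := Ap _ (nbhsx_ballx p _ n0).
  by rewrite -ball_normE/= distrC => /ltW px; exists x.
exists u => [n|]; first by have [] := uP n.
apply: (@cvg_le _ _ _ _ H R[i]^o u _ p 0 1 ler01 _ (@cvg_harmonicC R)) => n.
have [_ /le_trans] := uP n; apply; rewrite mul1r.
have : (n.+1%:R^-1 : R[i]) <= `|n.+1%:R^-1 - 0|.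
  by rewrite subr0 ger0_norm// invr_ge0.
exact.
Qed.

(** * Square roots of nonnegative contractions *)

(** In the partial order, [0 <= l] amounts to l = |l|; both sides are limits of [z]. *)
Lemma cvg_ge0 (R : realType) (z : nat -> R[i]) (l : R[i]) :
  (forall n, 0 <= z n) -> (z : nat -> R[i]^o) @ \oo --> (l : R[i]^o) -> 0 <= l.
Proof.
move=> z0 zl; suff -> : l = `|l| by [].
apply: (@cvg_unique R[i]^o (@norm_hausdorff _ _) ((z : nat -> R[i]^o) @ \oo)).
  exact: zl.
apply: (@cvg_le _ _ _ _ R[i]^o R[i]^o z z `|l| l 1 ler01 _ zl) => n.
have : `|z n - `|l| | <= `|z n - l|.
  by rewrite -{1}(ger0_norm (z0 n)) ler_dist_dist.
by rewrite mul1r.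
Qed.

Section square_root.
Context {R : realType} {K : hilbertType R}.
Implicit Types T S : {linear K -> K}.

Lemma complementE T k : complement T k = k - T k.
Proof. by []. Qed.

Lemma linear_operator (f : K -> K) :
  (forall a x y, f (a *: x + y) = a *: f x + f y) ->
  exists T : {linear K -> K}, forall k, T k = f k.
Proof.
move=> fL.
pose T : {linear K -> K} := HB.pack f (GRing.isLinear.Build _ _ _ _ f fL).
by exists T.
Qed.

Section operator_form.
Variable T : {linear K -> K}.

Let operator_form_linearl (a : R[i]) (x y z : K) : setT x -> setT y -> setT z ->
  (| T (a *: x + y), z |) = a * (| T x, z |) + (| T y, z |).
Proof. by move=> _ _ _; rewrite linearP innerDl innerZl. Qed.

Let operator_form_antilinearr (a : R[i]) (x y z : K) :
  setT x -> setT y -> setT z ->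
  (| T z, a *: x + y |) = a^* * (| T z, x |) + (| T z, y |).
Proof. by move=> _ _ _; rewrite innerDr innerZr. Qed.

Definition operator_form : sesq_form K :=
  Form subspace_setT operator_form_linearl operator_form_antilinearr.

End operator_form.

(** Cauchy-Schwarz for the form (T x, y) at [k] and [T k] bounds |T k|^4 by (T k, k) (T T k, T k) <=
    |k|^2 |T k|^2. *)
Lemma contraction_norm T k : nonnegative_contraction T -> `|T k| <= `|k|.
Proof.
move=> [[_ _ T0] T1].
have := @form_cauchy_schwarz _ _ (operator_form T)
  (fun x _ => T0 x) k (T k) I I.
rewrite /= -inner_norm => h.
have {}h : `|T k| ^+ 2 * `|T k| ^+ 2 <= `|k| ^+ 2 * `|T k| ^+ 2.
  rewrite {1}ger0_norm ?exprn_ge0// in h; rewrite -expr2.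
  by apply: (le_trans h); apply: ler_pM; rewrite ?T0// inner_norm T1.
have [->|Tk0] := eqVneq (T k) 0; first by rewrite normr0.
rewrite -(@ler_pXn2r _ 2)// ?nnegrE//.
by rewrite ler_pM2r// in h; rewrite exprn_gt0// normr_gt0.
Qed.

Lemma complement_contraction T :
  nonnegative_contraction T -> nonnegative_contraction (complement T).
Proof.
move=> TC; have [[_ Tsa T0] T1] := TC; split; first split.
- exists 2 => k; rewrite complementE rmorph_nat.
  apply: (le_trans (ler_normB _ _)).
  by rewrite mulr_natl mulr2n lerD2l contraction_norm.
- by move=> k l; rewrite !complementE innerBl innerBr Tsa.
- by move=> k; rewrite complementE innerBl subr_ge0.
- by move=> k; rewrite complementE innerBl gerBl.
Qed.

Section iteration.
Variable T : {linear K -> K}.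
Hypothesis TC : nonnegative_contraction T.
Local Notation A := (complement T).

Let A_norm k : `|A k| <= `|k|.
Proof. exact/contraction_norm/complement_contraction. Qed.

(* The iterates of S |-> (S^2 + I - T) / 2 converge to I - sqrt T.  The scalar
   sequence sqrt_iter_bound, which is the same iteration for T = 0, dominates
   their norms and their increments. *)
Definition sqrt_step S : {linear K -> K} := (2^-1 : R[i]) \*: (S \o S \+ A).

Definition sqrt_iter n : {linear K -> K} :=
  iter n sqrt_step (\0 : {linear K -> K}).

Fixpoint sqrt_iter_bound n : R :=
  if n is n.+1 then (sqrt_iter_bound n ^+ 2 + 1) / 2 else 0.

Arguments sqrt_iter : simpl never.
Arguments sqrt_iter_bound : simpl never.

Local Notation X := sqrt_iter.
Local Notation a := sqrt_iter_bound.

Let iterS n k : X n.+1 k = 2^-1 *: (X n (X n k) + A k).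
Proof. by []. Qed.

Let boundS n : a n.+1 = (a n ^+ 2 + 1) / 2.
Proof. by []. Qed.

(** Each [X n] is a polynomial in [A]. *)
Let iter_comm (B : {linear K -> K}) n :
  (forall k, A (B k) = B (A k)) -> forall k, X n (B k) = B (X n k).
Proof.
move=> AB; elim: n => [k|n IH k]; first by rewrite [RHS]raddf0.
by rewrite !iterS !IH AB [RHS]linearZ/= [in RHS]raddfD.
Qed.

Let iter_comm2 n m k : X n (X m k) = X m (X n k).
Proof. by apply: iter_comm => {}k; rewrite iter_comm. Qed.

Let iter_selfadjoint n : selfadjoint (X n).
Proof.
have [[_ Asa _] _] := complement_contraction TC.
elim: n => [k l|n IH k l]; first by rewrite [LHS]inner0l inner0r.
rewrite !iterS innerZl innerZr innerDl innerDr !IH Asa.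
by rewrite fmorphV/= rmorph_nat.
Qed.

Let bound_ge0 n : 0 <= a n.
Proof. by case: n => // n; rewrite boundS divr_ge0// addr_ge0// sqr_ge0. Qed.

Let bound_le1 n : a n <= 1.
Proof.
elim: n => [|n IH]; rewrite ?ler01// boundS ler_pdivrMr// mul1r lerD2r.
by rewrite expr_le1.
Qed.

Let bound_nondecreasing : nondecreasing_seq a.
Proof.
apply/nondecreasing_seqP => n.
rewrite boundS ler_pdivlMr// -subr_ge0.
by have -> : a n ^+ 2 + 1 - a n * 2 = (a n - 1) ^+ 2; [ring|exact: sqr_ge0].
Qed.

Let iter_norm n k : `|X n k| <= (a n)%:C%C * `|k|.
Proof.
elim: n k => [k|n IH k]; first by rewrite [X 0%N k]/(0 : K) normr0 mul0r.
rewrite iterS boundS normrZ ger0_norm ?invr_ge0//.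
rewrite rmorphM/= fmorphV/= rmorph_nat.
rewrite [Z in Z * `|k|]mulrC -mulrA ler_wpM2l ?invr_ge0//.
apply: (le_trans (ler_normD _ _)); rewrite rmorphD/= rmorph1 mulrDl mul1r.
apply: lerD; last exact: A_norm.
rewrite expr2 rmorphM/= -mulrA; apply: (le_trans (IH _)).
by rewrite ler_wpM2l ?ler0c.
Qed.

Let iter_norm1 n k : `|X n k| <= `|k|.
Proof.
apply: (le_trans (iter_norm n k)).
by rewrite ler_piMl// -(rmorph1 (real_complex R)) lecR.
Qed.

Let iter_step n k : `|X n.+1 k - X n k| <= (a n.+1 - a n)%:C%C * `|k|.
Proof.
elim: n k => [k|n IH k].
  rewrite iterS boundS [X 0%N _]/(0 : K) [X 0%N k]/(0 : K) add0r subr0.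
  rewrite [a 0%N]/(0 : R) expr0n add0r subr0 normrZ ger0_norm ?invr_ge0// mul1r.
  rewrite fmorphV/= rmorph_nat ler_wpM2l ?invr_ge0//.
  exact: A_norm.
(* A difference of two squares, factored because the iterates commute; the scalar sequence factors
   in the same way. *)
have -> : X n.+2 k - X n.+1 k =
    2^-1 *: (X n.+1 (X n.+1 k - X n k) + X n (X n.+1 k - X n k)).
  have XB m x y : X m (x - y) = X m x - X m y by exact: linearB.
  rewrite [X n.+2 k]iterS [Z in _ - Z = _]iterS -scalerBr !XB.
  rewrite [X n (X n.+1 k)]iter_comm2; congr (_ *: _).
  by rewrite [RHS]addrA subrK opprD addrACA subrr addr0.
move: (X n.+1 k - X n k) (IH k) => d dP.
have : `|X n.+1 d + X n d| <=
    (a n.+1 + a n)%:C%C * ((a n.+1 - a n)%:C%C * `|k| ).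
  apply: (le_trans (ler_normD _ _)).
  apply: (le_trans (lerD (iter_norm _ _) (iter_norm _ _))).
  by rewrite -mulrDl -rmorphD/= ler_wpM2l// ler0c addr_ge0.
move: (X n.+1 d + X n d) => e eP.
rewrite normrZ ger0_norm ?invr_ge0//.
have -> : a n.+2 - a n.+1 = 2^-1 * ((a n.+1 + a n) * (a n.+1 - a n)).
  by rewrite [a n.+2]boundS [Z in _ - Z = _]boundS; field.
rewrite rmorphM/= fmorphV/= rmorph_nat -mulrA ler_wpM2l ?invr_ge0//.
by rewrite rmorphM/= -mulrA.
Qed.

(** The increments telescope, and since [a] is nondecreasing their bounds add up to exactly |a n - a
    m|. *)
Let iter_dist n m k : `|X n k - X m k| <= `|a n - a m|%:C%C * `|k|.
Proof.
wlog : n m / (m <= n)%N => [h|/subnK <-].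
  by have [/h//|/ltnW/h] := leqP m n; rewrite distrC [`|a m - _|]distrC.
elim: (n - m)%N => [|d IH]; first by rewrite add0n !subrr !normr0 mul0r.
rewrite addSn -(subrKA (X (d + m)%N k)); apply: (le_trans (ler_normD _ _)).
apply: (le_trans (lerD (iter_step _ _) IH)).
have mono i j : (i <= j)%N -> `|a j - a i| = a j - a i.
  by move=> ij; rewrite ger0_norm// subr_ge0 bound_nondecreasing.
rewrite !mono ?leq_addl//; last by rewrite -addSn leq_addl.
by rewrite -mulrDl -rmorphD/= subrKA.
Qed.

Let iter_cvg k : exists l : K, (fun n => X n k) @ \oo --> l.
Proof.
apply: cauchy_seq_cvg.
have [l al] : exists l : R, a @ \oo --> l.
  exists (sup (range a)); apply: nondecreasing_cvgn => //.
  by exists 1 => _ [n _ <-].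
have : (fun p : nat * nat => a p.1 - a p.2) @ (\oo, \oo) --> (0 : R).
  rewrite -(subrr l).
  apply: (@cvgB R R _ _ _ (fun p : nat * nat => a p.1) (fun p => a p.2)).
    by apply: cvg_comp al; exact: cvg_fst.
  by apply: cvg_comp al; exact: cvg_snd.
move/cvg0_real; apply: (@cvg0_le _ _ _ _ K R[i]^o _ _ `|k| ) => // -[n m].
rewrite mulrC; apply: (le_trans (iter_dist n m k)).
by rewrite ler_wpM2r// normc_def/= expr0n addr0 sqrtr_sqr.
Qed.

Lemma sqrt_exists : exists S : {linear K -> K},
  nonnegative_operator S /\ forall k, S (S k) = T k.
Proof.
have /choice[L LP] := iter_cvg.
have Luniq k (l : K) : (fun n => X n k) @ \oo --> l -> l = L k.
  by move=> kl; apply: cvg_unique kl (LP k); exact: norm_hausdorff.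
have [Y YE] : exists Y : {linear K -> K}, forall k, Y k = L k.
  apply: linear_operator => b x y; apply/esym/Luniq.
  have -> : (fun n => X n (b *: x + y)) = (fun n => b *: X n x + X n y).
    by apply/funext => n; rewrite linearP.
  by apply: cvgD; [apply: cvgZr; exact: LP|exact: LP].
have YP k : (fun n => X n k) @ \oo --> Y k by rewrite YE.
have Ysa : selfadjoint Y.
  move=> k l; apply: (cvg_inner_unique (YP k)).
  have -> : (fun n => (| X n k, l |) : R[i]) = (fun n => (| k, X n l |)).
    by apply/funext => n; exact: iter_selfadjoint.
  exact: cvg_inner_r.
(* The fixed point equation 2 Y = Y^2 + (I - T), which is (I - Y)^2 = T. *)
have Yfix k : 2 *: Y k = Y (Y k) + A k.
  have XX : (fun n => X n (X n k)) @ \oo --> Y (Y k).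
    rewrite -[Y (Y k)]add0r.
    (* The error [X n k - Y k] is not enlarged by the outer [X n], which has norm at most 1. *)
    have -> : (fun n => X n (X n k)) =
        (fun n => X n (X n k - Y k) + X n (Y k)).
      by apply/funext => n; rewrite linearB/= subrK.
    apply: cvgD => //.
    apply: (@cvg0_le _ _ _ _ K K _ (fun n => X n k - Y k) 1) => // [n|].
      by rewrite mul1r iter_norm1.
    by apply/subr_cvg0.
  have : (fun n => 2 *: X n.+1 k) @ \oo --> 2 *: Y k.
    by apply: cvgZr; have := YP k; rewrite -(cvg_shiftS (fun n => X n k)).
  have -> : (fun n => 2 *: X n.+1 k) = (fun n => X n (X n k) + A k).
    by apply/funext => n; rewrite iterS scalerA mulfV ?pnatr_eq0// scale1r.
  move=> h; apply: (cvg_unique _ h); first exact: norm_hausdorff.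
  by apply: cvgD => //; exact: cvg_cst.
have SS k : complement Y (complement Y k) = T k.
  rewrite !complementE linearB/= opprB.
  have -> : Y (Y k) = 2 *: Y k - A k by rewrite Yfix addrK.
  rewrite complementE scaler_nat mulr2n opprB [_ + _ - Y k]addrAC addrK.
  by rewrite [LHS]addrA subrK addrC subrK.
have [[_ _ T0] T1] := TC.
have Ssa : selfadjoint (complement Y).
  by move=> k l; rewrite !complementE innerBl innerBr Ysa.
exists (complement Y); split; last exact: SS.
split; [|exact: Ssa|].
  (* With S = I - Y: |S k|^2 = (S S k, k) = (T k, k) <= |k|^2. *)
  exists 1 => k; rewrite rmorph1 mul1r -(@ler_pXn2r _ 2)// ?nnegrE//.
  by rewrite !inner_norm -Ssa SS.
(* Each I - X n is nonnegative, as [X n] is selfadjoint with norm at most 1; this passes to the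
   limit. *)
move=> k; apply: (@cvg_ge0 _ (fun n => (| k - X n k, k |))) => [n|].
  rewrite innerBl subr_ge0 -inner_norm.
  have : `|(| X n k, k |)| <= `|k| ^+ 2.
    apply: (le_trans (cauchy_schwarz _ _)).
    by rewrite expr2 ler_wpM2r// iter_norm1.
  apply: le_trans; apply: real_ler_norm; apply/CrealP.
  by rewrite -innerC iter_selfadjoint.
by apply: cvg_inner_l; apply: cvgB => //; exact: cvg_cst.
Qed.

End iteration.

Lemma sqrt_operatorP T : nonnegative_contraction T ->
  nonnegative_operator (sqrt_operator T) /\
  forall k, sqrt_operator T (sqrt_operator T k) = T k.
Proof. by move=> TC; exact: (getPex (sqrt_exists TC)). Qed.

End square_root.

(** * Lebesgue type decompositions *)

Section form_lemmas.
Context {R : realType} {H : hilbertType R}.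
Implicit Types t s : sesq_form H.

Lemma eq_form_closable t s : eq_form t s -> closable t -> closable s.
Proof.
move=> [domE ts] tc u su u0 us0.
have tu n : dom t (u n) by rewrite domE.
have E v : dom t v -> t v v = s v v by move=> tv; exact: ts.
have : (fun n => t (u n) (u n) : R[i]^o) @ \oo --> (0 : R[i]^o).
  apply: tc => //.
  have -> : (fun p : nat * nat => t (u p.1 - u p.2) (u p.1 - u p.2)) =
            (fun p : nat * nat => s (u p.1 - u p.2) (u p.1 - u p.2)).
    by apply/funext => p; apply: E; exact: (subspaceB (dom_subspace t)).
  exact: us0.
have -> : (fun n => t (u n) (u n)) = (fun n => s (u n) (u n)).
  by apply/funext => n; exact: E.
exact.
Qed.

(** For each nonzero [x], every lower bound is at most t[x] / |x|^2; so is their supremum, and hence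
    [c]. *)
Lemma le_lower_bound t (c : R) : semibounded t ->
  (c%:E <= lower_bound t)%E -> is_lower_bound t c.
Proof.
move=> [b tb] ct x tx.
(* Semiboundedness makes t[x] - b |x|^2 nonnegative, and therefore t[x] real. *)
have tr : t x x = (complex.Re (t x x))%:C%C.
  rewrite RRe_real//; have := tb x tx; rewrite -subr_ge0 => /ger0_real h.
  rewrite -[t x x](subrK (b%:C%C * `|x| ^+ 2)); apply: rpredD => //.
  apply: rpredM; first by apply/complex_realP; exists b.
  by apply: rpredX; exact: normr_real.
have [x0|xn0] := eqVneq x 0.
  by rewrite x0 normr0 expr0n mulr0 form00.
have nx : `|x| = (complex.Re `|x| )%:C%C by rewrite RRe_real ?normr_real.
set r := complex.Re (t x x) in tr; set m := complex.Re `|x| in nx.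
have m0 : 0 < m ^+ 2.
  by rewrite exprn_gt0// -ltcR -nx normr_gt0.
have bound d : is_lower_bound t d -> d <= r / m ^+ 2.
  move=> /(_ x tx); rewrite nx tr -rmorphXn -rmorphM/= lecR.
  by rewrite ler_pdivlMr.
have : (c%:E <= (r / m ^+ 2)%:E)%E.
  apply: (le_trans ct); apply: ge_ereal_sup => _ [d dt <-].
  by rewrite lee_fin bound.
rewrite lee_fin ler_pdivlMr// => cm.
by rewrite nx tr -rmorphXn -rmorphM/= lecR.
Qed.

End form_lemmas.

(** * Closability of a form in terms of its representing operator *)

Section closable_operator.
Context {R : realType} {H K : hilbertType R} (c : R) (P : operator H K).
Local Notation D := (op_dom P).
Local Notation t := (add_scalar c (gram_form P)).

Lemma cvg_sub_diag (V : normedModType R[i]) (u : nat -> V) (l : V) :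
  u @ \oo --> l ->
  (fun p : nat * nat => u p.1 - u p.2) @ (\oo, \oo) --> (0 : V).
Proof.
move=> ul; rewrite -(subrr l).
apply: (@cvgB _ V _ _ _ (fun p : nat * nat => u p.1) (fun p => u p.2)).
  by apply: cvg_comp ul; exact: cvg_fst.
by apply: cvg_comp ul; exact: cvg_snd.
Qed.

Lemma cvg0_scaled_inner (T : Type) (F : set_system T) (FF : Filter F)
  (w : T -> H) :
  w @ F --> (0 : H) ->
  (fun n => c%:C%C * (| w n, w n |) : R[i]^o) @ F --> (0 : R[i]^o).
Proof.
move=> /cvg0_inner w0.
apply: (@cvg0_le _ _ _ _ R[i]^o R[i]^o _ _ `|c%:C%C| _ _ w0) => // n.
by have : `|c%:C%C * (| w n, w n |)| <= `|c%:C%C| * `|(| w n, w n |)|;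
  [rewrite normrM|exact].
Qed.

(** Along a null sequence the term with [c] vanishes, so t[u_n - u_m] -> 0 means that P u_n is
    Cauchy. It then converges to some [l] by completeness of [K], and t[u_n] -> |l|^2. *)
Lemma closable_gramP : closable t <->
  forall (u : nat -> H) (l : K), (forall n, D (u n)) ->
    u @ \oo --> (0 : H) -> P \o u @ \oo --> l -> l = 0.
Proof.
split=> [tc u l Du u0 Pul|tc u Du u0 tu].
  have : (fun n => t (u n) (u n) : R[i]^o) @ \oo --> (0 : R[i]^o).
    apply: tc => //; rewrite -[0 in X in _ --> X]addr0.
    apply: (@cvgD R[i] R[i]^o).
      by apply: cvg0_scaled_inner; exact: cvg_sub_diag u0.
    have E : (fun p : nat * nat => P (u p.1 - u p.2)) =
             (fun p : nat * nat => (P \o u) p.1 - (P \o u) p.2).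
      by apply/funext => p; rewrite /= op_subB.
    apply: (@cvg0_inner _ K _ _ _ (fun p : nat * nat => P (u p.1 - u p.2))).
    by rewrite E; exact: cvg_sub_diag Pul.
  move=> tu; have Pu0 : P \o u @ \oo --> (0 : K).
    pose g n := t (u n) (u n) - c%:C%C * (| u n, u n |).
    have g0 : (g : nat -> R[i]^o) @ \oo --> (0 : R[i]^o).
      rewrite -[0 in X in _ --> X](subr0 0).
      by apply: (@cvgB R[i] R[i]^o) => //; exact: cvg0_scaled_inner.
    apply: (@cvg0_sqr_le _ _ _ _ K R[i]^o _ g 1 ler01 _ g0) => n.
    have : `|P (u n)| ^+ 2 <= `|g n|.
      by rewrite /g /= addrC addKr -inner_norm normrX normr_id.
    by rewrite mul1r.
  by apply: cvg_unique Pul Pu0; exact: norm_hausdorff.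
have {}Du n : D (u n) := Du n.
pose w (p : nat * nat) := u p.1 - u p.2.
have Pw : (fun p => (P \o u) p.1 - (P \o u) p.2) @ (\oo, \oo) --> (0 : K).
  pose g p := t (w p) (w p) - c%:C%C * (| w p, w p |).
  have g0 : (g : nat * nat -> R[i]^o) @ (\oo, \oo) --> (0 : R[i]^o).
    rewrite -[0 in X in _ --> X](subr0 0); apply: (@cvgB R[i] R[i]^o) => //.
    by apply: cvg0_scaled_inner; exact: cvg_sub_diag u0.
  apply: (@cvg0_sqr_le _ _ _ _ K R[i]^o _ g 1 ler01 _ g0) => p.
  have : `|P (u p.1) - P (u p.2)| ^+ 2 <= `|g p|.
    rewrite -op_subB// /g /= [_ * _ + _]addrC addrK.
    by rewrite -inner_norm normrX normr_id.
  by rewrite mul1r.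
have [l Pul] := cauchy_seq_cvg Pw.
rewrite -[0 in X in _ --> X]addr0; apply: (@cvgD R[i] R[i]^o).
  exact: cvg0_scaled_inner.
apply: (@cvg0_inner _ K _ _ _ (P \o u)).
by rewrite -[X in _ --> X](tc u l).
Qed.

End closable_operator.

(** * Representation of a dominated nonnegative form by a contraction *)

Section dominated_form.
Context {R : realType} {H K : hilbertType R}.
Context (Q : operator H K) (s : sesq_form H).
Hypothesis s_dom : dom s = op_dom Q.
Hypothesis s0 : nonnegative_form s.
Hypothesis s_le : forall x, op_dom Q x -> s x x <= `|Q x| ^+ 2.
Local Notation D := (op_dom Q).
Local Notation ran := (Q @` op_dom Q).

Let DS : subspace_set D := op_dom_subspace Q.

Let ranS : subspace_set ran := subspace_range Q.

Let cl_ranS : subspace_set (closure ran) := subspace_closure ranS.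

Let s_norm x y : D x -> D y -> `|s x y| <= `|Q x| * `|Q y|.
Proof.
move=> Dx Dy; rewrite -(@ler_pXn2r _ 2)// ?nnegrE ?mulr_ge0// exprMn.
apply: (le_trans (form_cauchy_schwarz s0 _ _)); rewrite ?s_dom//.
by rewrite ler_pM ?s_le// s0// s_dom.
Qed.

Lemma dominated_form_representation : exists2 T : {linear K -> K},
  nonnegative_contraction T &
  forall x y, D x -> D y -> s x y = (| T (Q x), Q y |).
Proof.
(* E is to be T \o Q; T k is then found from (| T k, Q y |) = (| k, E y |). *)
have /choice[E EP] : forall x, exists e, D x ->
    [/\ closure ran e, forall y, D y -> (| e, Q y |) = s x y & `|e| <= `|Q x| ].
  (* Outside [D] the value 0 is a default. *)
  move=> x; have [Dx|nDx] := pselect (D x); last by exists 0.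
  have [||e eP] := @riesz_operator _ _ _ Q (s x) `|Q x| (normr_ge0 _).
  - by move=> a y z Dy Dz; rewrite form_antilinearr// s_dom.
  - by move=> y Dy; exact: s_norm.
  by exists e.
have EQ x y : D x -> D y -> (| E x, Q y |) = s x y by move=> /EP[_ + _]; exact.
have EL a x y : D x -> D y -> E (a *: x + y) = a *: E x + E y.
  move=> Dx Dy; have Dz : D (a *: x + y) by exact: DS.2.
  have [[Cx _ _] [Cy _ _] [Cz _ _]] := And3 (EP _ Dx) (EP _ Dy) (EP _ Dz).
  apply: (closure_unique Cz); first exact: cl_ranS.2.
  move=> _ [z Dw <-].
  by rewrite innerDl innerZl !EQ// form_linearl// s_dom.
have /choice[L LP] : forall k, exists e,
    [/\ closure ran e, forall y, D y -> (| e, Q y |) = (| k, E y |)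
      & `|e| <= `|k| ].
  move=> k.
  apply: (@riesz_operator _ _ _ Q (fun y => (| k, E y |)) `|k| ) => //.
    by move=> a x y Dx Dy; rewrite EL// innerDr innerZr.
  move=> y Dy; apply: (le_trans (cauchy_schwarz _ _)).
  by have [_ _ Ey] := EP _ Dy; rewrite ler_wpM2l.
have [T TE] : exists T : {linear K -> K}, forall k, T k = L k.
  apply: linear_operator => a k l.
  have [[Ck kE _] [Cl lE _] [Cm mE _]] := And3 (LP k) (LP l) (LP (a *: k + l)).
  apply: (closure_unique Cm); first exact: cl_ranS.2.
  move=> _ [y Dy <-].
  by rewrite mE// !innerDl !innerZl kE// lE.
have TC k : closure ran (T k) by rewrite TE; have [] := LP k.
have TQ k y : D y -> (| T k, Q y |) = (| k, E y |).
  by rewrite TE; have [_ + _] := LP k; exact.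
have T1 k : `|T k| <= `|k| by rewrite TE; have [] := LP k.
have sT x y : D x -> D y -> s x y = (| T (Q x), Q y |).
  move=> Dx Dy; rewrite TQ// innerC EQ//.
  by rewrite (nonnegative_form_herm s0) ?s_dom// conjCK.
have Tperp k : (forall z, ran z -> (| k, z |) = 0) -> T k = 0.
  move=> kran; apply: (closure_unique (TC k)); first exact: cl_ranS.1.
  move=> _ [y Dy <-]; rewrite TQ// inner0l.
  by have [Ey _ _] := EP _ Dy; exact: closure_orthogonal Ey.
have T_cvg (u : nat -> K) (p : K) : u @ \oo --> p ->
  (fun n => T (u n)) @ \oo --> T p.
  apply: (@cvg_le _ _ _ _ K K _ _ _ _ 1 ler01) => n.
  by rewrite mul1r -linearB T1.
(* Since [T] maps into the closure of [ran] and vanishes on its orthogonal complement, [k] may be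
   replaced by its projection [p], a limit of vectors Q u_n. Symmetry and positivity of [T] then
   follow from those of [s] by continuity. *)
have reduce k : exists2 u : nat -> H, forall n, D (u n) &
    exists p, [/\ Q \o u @ \oo --> p, T k = T p &
                  forall l, (| T l, k |) = (| T l, p |)].
  have [p [r [kE Cp rran]]] := orthogonal_decomposition ranS k.
  have [v vran vp] := closure_sequence Cp.
  have /choice[u uP] : forall n, exists x, D x /\ Q x = v n.
    by move=> n; have [x Dx xv] := vran n; exists x.
  exists u => [n|]; first by have [] := uP n.
  exists p; split.
  - by have -> : Q \o u = v by apply/funext => n; have [] := uP n.
  - by rewrite kE linearD (Tperp r)// addr0.
  - move=> l; rewrite kE innerDr [X in _ + X]innerC.
    by rewrite (closure_orthogonal rran (TC l)) conjC0 addr0.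
have Tsa : selfadjoint T.
  move=> k l; have [u Du [p [up -> kp]]] := reduce k.
  have [v Dv [r [vr Tl lr]]] := reduce l.
  rewrite lr Tl [RHS]innerC -Tl kp Tl -innerC.
  apply: (@cvg_unique R[i]^o (@norm_hausdorff _ _)
    ((fun n => (| T (Q (u n)), Q (v n) |) : R[i]^o) @ \oo)).
    by apply: cvg_inner => //; exact: T_cvg up.
  have -> : (fun n => (| T (Q (u n)), Q (v n) |) : R[i]) =
            (fun n => (| Q (u n), T (Q (v n)) |)).
    apply/funext => n; rewrite -sT// [RHS]innerC -sT//.
    by rewrite -(nonnegative_form_herm s0) ?s_dom.
  by apply: cvg_inner => //; exact: T_cvg vr.
have T0 k : 0 <= (| T k, k |).
  have [u Du [p [up Tp kp]]] := reduce k.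
  rewrite kp Tp; apply: (@cvg_ge0 _ (fun n => (| T (Q (u n)), Q (u n) |))).
    by move=> n; rewrite -sT// s0// s_dom.
  by apply: cvg_inner => //; exact: T_cvg up.
exists T => //; split; first split => //.
  by exists 1 => k; rewrite rmorph1 mul1r.
move=> k; rewrite -[leLHS](ger0_norm (T0 k)) -inner_norm expr2.
by apply: (le_trans (cauchy_schwarz _ _)); rewrite ler_wpM2r.
Qed.

End dominated_form.

(** * The two conditions on the contraction, compared with closability and singularity *)

Section lebesgue_decomposition.
Context {R : realType} {H K : hilbertType R} (Q : operator H K).
Local Notation D := (op_dom Q).
Let DS : subspace_set D := op_dom_subspace Q.

Lemma dom_adjoint_subspace : subspace_set (dom_adjoint Q).
Proof.
split; first by exists 0 => x Dx /=; rewrite !inner0l.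
move=> a k l [h kh] [g lg]; exists (a *: h + g) => x Dx /=.
have := lg x Dx; have := kh x Dx => /= khx lgx.
by rewrite !innerDl !innerZl khx lgx.
Qed.

Variable T : {linear K -> K}.
Hypothesis TC : nonnegative_contraction T.

Local Notation A := (sqrt_operator T).
Local Notation B := (sqrt_operator (complement T)).

Let Asa : selfadjoint A. Proof. by have [[]] := sqrt_operatorP TC. Qed.

Let Bsa : selfadjoint B.
Proof. by have [[]] := sqrt_operatorP (complement_contraction TC). Qed.

Let BB k : B (B k) = complement T k.
Proof. by have [_] := sqrt_operatorP (complement_contraction TC). Qed.

Lemma inner_sqrt x y : (| A x, A y |) = (| T x, y |).
Proof. by have [_ AA] := sqrt_operatorP TC; rewrite -Asa AA. Qed.

Lemma inner_sqrt_complement x y : (| B x, B y |) = (| x, y |) - (| T x, y |).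
Proof. by rewrite -Bsa BB complementE innerBl. Qed.

(** Because |B k|^2 = (B B k, k) = ((I - T) k, k). *)
Lemma range_complement_orthogonal k :
  (forall z, range (complement T) z -> (| k, z |) = 0) -> B k = 0.
Proof.
by move=> kran; apply: inner_eq0; rewrite -Bsa BB innerC kran ?conjC0.
Qed.

Lemma subspace_range_complement : subspace_set (range (complement T)).
Proof.
split; first by exists 0 => //; rewrite linear0.
move=> a _ _ [x _ <-] [y _ <-]; exists (a *: x + y) => //.
by rewrite linearP.
Qed.

Lemma closability_condition_closable (c : R) :
  closability_condition Q T -> closable (contraction_form1 c Q T).
Proof.
move=> TQ; apply/closable_gramP => u l Du u0 Bul.
have {}Du n : D (u n) := Du n.
have lran z : range (complement T) z -> (| l, z |) = 0.
  move=> /(@subset_closure _ (range (complement T))); rewrite -TQ.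
  apply: closure_orthogonal => m [_ [h hm]].
  apply: cvg_inner_unique Bul _.
  (* Here [h] is an adjoint image of [B m], so the pairing with [m] moves to [u n], which tends to
     0. *)
  have -> : (fun n => (| (op_comp B Q \o u) n, m |) : R[i]) =
            (fun n => (| u n, h |)).
    apply/funext => n; rewrite /= Bsa [LHS]innerC [RHS]innerC; congr (_^*).
    by have /= -> := hm (u n) (Du n).
  by rewrite -[X in _ --> (X : R[i]^o)](inner0l h); exact: cvg_inner_l.
have Bl0 := range_complement_orthogonal lran.
apply: inner_eq0; apply: cvg_inner_unique Bul _.
have -> : (fun n => (| (op_comp B Q \o u) n, l |) : R[i]) = (fun=> 0).
  by apply/funext => n; rewrite /= Bsa Bl0 inner0r.
exact: cvg_cst.
Qed.

Lemma singularity_conditionP :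
  singularity_condition Q T <-> singular (contraction_form2 Q T).
Proof.
split=> [TQ x Dx|sT _ [[k _ <-] [h hk]] x Dx /=].
  have [|u [Du ux AQu]] := @graph_closure _ _ _ (op_comp A Q) x 0.
    move=> h k hk; rewrite inner0r addr0.
    have /TQ Ak : (range A `&` dom_adjoint Q) (A k).
      split; first by exists k.
      (* Orthogonality of [(h, k)] to the graph of A Q reads (A k, Q y) = - (h, y). *)
      exists (- h) => y Dy /=; rewrite Asa.
      by have /= /eqP := hk y Dy; rewrite addr_eq0 innerNl => /eqP ->;
        rewrite opprK.
    have := hk x Dx; rewrite /= -Asa -(Ak x Dx) /= inner0l addr0; exact.
  exists u; split => //.
  by apply: (@cvg0_inner _ K _ _ _ (op_comp A Q \o u)).
rewrite inner0l.
have [u [Du ux tu]] := sT x Dx.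
have {}Du n : D (u n) := Du n.
apply/esym; have /= <- := hk x Dx; rewrite innerC.
(* Along the sequence given by singularity, (u_n, h) = (A Q u_n, k) tends both to (x, h) and to
   0. *)
have -> : (| x, h |) = 0.
  apply: cvg_inner_unique ux _.
  have -> : (fun n => (| u n, h |) : R[i]) = (fun n => (| A (Q (u n)), k |)).
    apply/funext => n; rewrite [LHS]innerC Asa [RHS]innerC; congr (_^*).
    by have /= -> := hk (u n) (Du n).
  rewrite -[X in _ --> (X : R[i]^o)](inner0l k); apply: cvg_inner_l.
  apply: (@cvg0_sqr_le _ _ _ _ K R[i]^o _ _ 1 ler01 _ tu) => n.
  have : `|A (Q (u n))| ^+ 2 <= `|(| A (Q (u n)), A (Q (u n)) |)|.
    by rewrite -inner_norm normrX normr_id.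
  by rewrite mul1r.
by rewrite conjC0.
Qed.

Lemma closable_closability_condition (c : R) :
  closable (contraction_form1 c Q T) -> closability_condition Q T.
Proof.
move=> /closable_gramP tc.
set ran := range (complement T).
have ranS : subspace_set ran := subspace_range_complement.
have cl_ranS := subspace_closure ranS.
pose M := [set k | closure ran k /\ dom_adjoint Q (B k)].
have MS : subspace_set M.
  have adjS := dom_adjoint_subspace; split.
    by split; [exact: cl_ranS.1|rewrite linear0; exact: adjS.1].
  move=> a x y [Cx Bx] [Cy By]; split; first exact: cl_ranS.2.
  by rewrite linearP; exact: adjS.2.
rewrite /closability_condition -/ran -/M.
apply/seteqP; split.
  by move=> k Mk; apply: closed_closure; apply: closureS Mk => m [].
(* By double orthogonality it suffices to test [p] against vectors [r] orthogonal to [M]; only the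
   component [r1] of [r] in the closure of [ran] pairs with [p]. *)
move=> p Cp; apply/(closure_subspaceP MS) => r rM.
have [r1 [r2 [rE Cr1 r2ran]]] := orthogonal_decomposition ranS r.
rewrite rE innerDl (closure_orthogonal r2ran Cp) addr0.
suff -> : r1 = 0 by rewrite inner0l.
have r1M m : M m -> (| r1, m |) = 0.
  move=> Mm; have := rM m Mm; rewrite rE innerDl.
  by rewrite (closure_orthogonal r2ran Mm.1) addr0.
(* Once [(0, r1)] is in the closed graph of B Q, closability forces [r1 = 0]. *)
have [|u [Du u0 BQu]] := @graph_closure _ _ _ (op_comp B Q) 0 r1; last first.
  exact: tc u0 BQu.
move=> h k hk; rewrite inner0r add0r.
have [k1 [k2 [kE Ck1 k2ran]]] := orthogonal_decomposition ranS k.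
(* Dropping [k2] does not change [B k], and [- h] is an adjoint image of [B k]; so [k1] is in [M]
   and thus orthogonal to [r1]. *)
have Mk1 : M k1.
  split => //; have -> : B k1 = B k.
    by rewrite kE linearD (range_complement_orthogonal k2ran) addr0.
  exists (- h) => y Dy /=; rewrite Bsa.
  by have /= /eqP := hk y Dy; rewrite addr_eq0 innerNl => /eqP ->;
    rewrite opprK.
rewrite kE innerDl [X in X + _]innerC (r1M _ Mk1) conjC0 add0r.
exact: closure_orthogonal Cr1.
Qed.

End lebesgue_decomposition.

Theorem theorem5p2 (R : realType) (H K : hilbertType R) (t : sesq_form H) (c : R)
    (Q : operator H K)
    (t_semibounded : semibounded t)
    (c_le : (c%:E <= lower_bound t)%E)
    (t_rep : eq_form t (add_scalar c (gram_form Q))) :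
  (forall T : {linear K -> K},
     nonnegative_contraction T ->
     closability_condition Q T ->
     singularity_condition Q T ->
     lebesgue_type_decomposition t
       (contraction_form1 c Q T) (contraction_form2 Q T))
  /\
  (forall t1 t2 : sesq_form H,
     lebesgue_type_decomposition t t1 t2 ->
     (c%:E <= lower_bound t1)%E ->
     exists T : {linear K -> K},
       [/\ nonnegative_contraction T,
           closability_condition Q T,
           singularity_condition Q T,
           eq_form t1 (contraction_form1 c Q T)
         & eq_form t2 (contraction_form2 Q T)]).
Proof.
have [t_dom t_val] := t_rep.
split=> [T TC T1 T2|
  t1 t2 [[t1_dom t2_dom t12] [t1_sb t1_cl] [t2_nn t2_sg]] c_le1].
  split; first split.
  - by rewrite t_dom.
  - by rewrite t_dom.
  - move=> x y tx ty.
    rewrite t_val//= (inner_sqrt TC) (inner_sqrt_complement TC).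
    by rewrite -addrA subrK.
  - split; last exact: closability_condition_closable.
    exists c => x _ /=; rewrite inner_norm lerDl; exact: inner_ge0.
  - split; first by move=> x _; exact: inner_ge0.
    exact/singularity_conditionP.
have domQ : dom t = op_dom Q by [].
have t1_ge := le_lower_bound t1_sb c_le1.
(* The bound [t1_ge] enters here: t2[x] = t[x] - t1[x] <= t[x] - c |x|^2 = |Q x|^2. *)
have t2_le x : op_dom Q x -> t2 x x <= `|Q x| ^+ 2.
  rewrite -domQ => tx; have := t12 x x tx tx.
  rewrite t_val//= -!inner_norm => E.
  have := t1_ge x; rewrite t1_dom => /(_ tx).
  by rewrite -(lerD2r (t2 x x)) -E lerD2l.
have [|T TC t2T] := dominated_form_representation _ t2_nn t2_le.
  by rewrite t2_dom.
have eq2 : eq_form t2 (contraction_form2 Q T).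
  split; first by rewrite t2_dom.
  by move=> x y; rewrite t2_dom domQ => Dx Dy; rewrite t2T//= (inner_sqrt TC).
(* Obtained by subtracting the representation of [t2] from that of [t]. *)
have eq1 : eq_form t1 (contraction_form1 c Q T).
  split; first by rewrite t1_dom.
  move=> x y; rewrite t1_dom => tx ty; rewrite /= (inner_sqrt_complement TC).
  have := t12 x y tx ty; rewrite t_val//= t2T -?domQ// => /eqP.
  by rewrite -subr_eq -addrA => /eqP <-.
exists T; split => //.
- by apply: closable_closability_condition => //; exact: eq_form_closable eq1 _.
- apply/singularity_conditionP => // x Dx.
  have [|u [Du ux tu]] := t2_sg x; first by rewrite t2_dom domQ.
  exists u; split => //; first by move=> n; rewrite -eq2.1.
  have -> : (fun n => contraction_form2 Q T (u n) (u n)) =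
            (fun n => t2 (u n) (u n)).
    by apply/funext => n; rewrite eq2.2.
  exact: tu.
Qed.
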